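(* Let $\rho\in(0,\pi]$ and $h>0$. Let $X_1,X_2,\ldots$ be i.i.d. observations in $\mathbb{R}^d$ drawn from a distribution $P_X$ with support $S$. Assume that $S$ is compact and standard with respect to $P_X$, and that $P_X\big(S\setminus (S\ominus tB(0,1))\big)=\mathcal{O}(t)$ as $t\to 0^+$. Denote $\aleph_n=\{X_1,\ldots,X_n\}$. (a) If $S\in\mathcal{C}_{\rho,h}$, then with probability one, for $n$ large enough, $$d_H\big(\partial S,\partial\mathbb{C}_{\rho,h}(\aleph_n)\big)\le k\, d_H(S,\aleph_n),\qquad k=3+\frac{2}{\sin(\rho/2)}.$$ (b) If $S\in\tilde{\mathcal{C}}_{\rho,h}$, then with probability one, for $n$ large enough, $$d_H\big(\partial S,\partial\tilde{\mathbb{C}}_{\rho,h}(\aleph_n)\big)\le k'\, d_H(S,\aleph_n),\qquad k'=3+\frac{2}{\sin(\rho'/2)},$$ where $\rho'=\rho$ if $\rho\le\pi/3$ and $\rho'=(\pi-\rho)/2$ if $\rho>\pi/3$ (for $\rho=\pi$ one has $\rho'=0$, $k'=+\infty$, and the assertion is void).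
   Context: $B(x,h)$ denotes the open Euclidean ball in $\mathbb{R}^d$ and $\mu$ the Lebesgue measure on $\mathbb{R}^d$. For $x\in\mathbb{R}^d$, a unit vector $\xi$, $\rho\in(0,\pi]$ and $h>0$, the finite open cone is $$C_{\rho,\xi,h}(x)=B(x,h)\cap\Big\{z\in\mathbb{R}^d,\ z\ne x:\ \Big\langle \xi,\frac{z-x}{\|z-x\|}\Big\rangle>\cos(\rho/2)\Big\}.$$ $\mathcal{C}_{\rho,h}$ is the class of nonempty compact sets $S\subset\mathbb{R}^d$ such that for every $x\in\partial S$ there is a unit vector $\xi$ with $C_{\rho,\xi,h}(x)\subset S^c$. $\tilde{\mathcal{C}}_{\rho,h}$ is the class of nonempty compact sets $S\subset\mathbb{R}^d$ such that $S$ equals the intersection of the complements of all cones $C_{\rho,\xi,h}(y)$ ($y\in\mathbb{R}^d$, $\|\xi\|=1$) disjoint from $S$. For a bounded set $A\subset\mathbb{R}^d$, $\mathbb{C}_{\rho,h}(A)$ is the intersection of all sets $B\in\mathcal{C}_{\rho,h}$ with $A\subset B$; $\tilde{\mathbb{C}}_{\rho,h}(A)$ is the intersection of the complements of all cones $C_{\rho,\xi,h}(y)$ disjoint from $A$ (equivalently, the intersection of all $B\in\tilde{\mathcal{C}}_{\rho,h}$ with $A\subset B$). A set $S\subset\mathbb{R}^d$ is standard with respect to a Borel measure $\nu$ if there exist $\lambda>0$, $\delta>0$ such that $\nu(B(x,\varepsilon)\cap S)\ge\delta\,\mu(B(x,\varepsilon))$ for all $x\in S$ and $0<\varepsilon\le\lambda$.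 The $t$-inner parallel set is $S\ominus tB(0,1)=\{x\in S: B(x,t)\subset S\}$. $d_H$ is the Hausdorff distance between nonempty compact sets. *)

(* Defs.v *)
From HB Require Import structures.
From mathcomp Require Import all_boot all_order all_algebra.
From mathcomp Require Import all_classical all_reals all_analysis.

Set Implicit Arguments.
Unset Strict Implicit.
Unset Printing Implicit Defensive.

Import Order.TTheory GRing.Theory Num.Theory.
Import numFieldNormedType.Exports.

Local Open Scope classical_set_scope.
Local Open Scope ring_scope.

(* Points of R^d are row vectors.  The library norm on 'rV[R]_d is the sup norm:
   it is used only through the topology it induces (open, closed, compact,
   closure, interior), which is the Euclidean one. *)

Section euclidean.
Variables (R : realType) (d : nat).
Implicit Types (x y z xi : 'rV[R]_d) (A B S : set 'rV[R]_d).

Definition dotp x y : R := \sum_(i < d) x ord0 i * y ord0 i.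

Definition enorm x : R := Num.sqrt (dotp x x).

Definition eball x (h : R) : set 'rV[R]_d := [set z | enorm (z - x) < h].

Definition boundary A : set 'rV[R]_d := closure A `\` interior A.

(* Extended-real valued, so that there are no junk values: it is +oo when no
   admissible radius exists. *)
Definition hausdorff A B : \bar R :=
  ereal_inf [set e%:E | e in [set e : R | 0 < e /\
    A `<=` \bigcup_(b in B) eball b e /\ B `<=` \bigcup_(a in A) eball a e]].

Definition inner_parallel S (t : R) : set 'rV[R]_d :=
  [set x | S x /\ eball x t `<=` S].

Definition cone (rho : R) xi (h : R) x : set 'rV[R]_d :=
  eball x h `&` [set z | z != x /\
    cos (rho / 2) < dotp xi ((enorm (z - x))^-1 *: (z - x))].

Definition cone_convex (rho h : R) : set (set 'rV[R]_d) :=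
  [set S | [/\ S !=set0, compact S &
    forall x, boundary S x ->
      exists xi, enorm xi = 1 /\ cone rho xi h x `<=` ~` S]].

Definition cone_hull (rho h : R) A : set 'rV[R]_d :=
  smallest (cone_convex rho h) A.

Definition cone_hull_compl (rho h : R) A : set 'rV[R]_d :=
  \bigcap_(C in [set C | exists y xi,
      [/\ enorm xi = 1, C = cone rho xi h y & C `&` A = set0]]) ~` C.

Definition cone_convex_compl (rho h : R) : set (set 'rV[R]_d) :=
  [set S | [/\ S !=set0, compact S & S = cone_hull_compl rho h S]].

End euclidean.

(* R^d with its Borel sigma-algebra. *)
Definition borel_rV (R : realType) (d : nat) :=
  g_sigma_algebraType (@open 'rV[R]_d).

(* Lebesgue measure on R^d as the d-fold product of the Lebesgue measure on R,
   by iterated integration over sections, as in the library's \x: on R^0 it is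
   the unit mass at the only point, and on R^(1 + d) the mass of A is the
   integral over x of the mass of the section {y | (x, y) in A}.  Only its values
   on Borel sets are meaningful. *)
Fixpoint lebesgue_rV (R : realType) (d : nat) : set 'rV[R]_d -> \bar R :=
  match d with
  | 0 => fun A => (\1_A (0 : 'rV[R]_0))%:E
  | d'.+1 => fun A =>
      (\int[lebesgue_measure]_x
         lebesgue_rV [set y : 'rV[R]_d' | A (row_mx (const_mx x : 'rV[R]_1) y)])%E
  end.

Lemma lebesgue_rV_set0 (R : realType) d : lebesgue_rV (set0 : set 'rV[R]_d) = 0%E.
Proof.
elim: d => [|d IH] /=; first by rewrite indicE in_set0.
by apply: integral0_eq => x _; rewrite [X in lebesgue_rV X](_ : _ = set0).
Qed.

Lemma lebesgue_rV_box (R : realType) d (a b : 'I_d -> R) :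
  (forall i, a i <= b i) ->
  lebesgue_rV [set y : 'rV[R]_d | forall i, a i <= y ord0 i <= b i] =
  (\prod_(i < d) (b i - a i))%:E.
Proof.
elim: d a b => [|d IH] a b ab /=.
  by rewrite big_ord0 indicE mem_set //; case.
rewrite big_ord_recl.
transitivity (\int[lebesgue_measure]_(x in `[a ord0, b ord0])
   ((\prod_(i < d) (b (lift ord0 i) - a (lift ord0 i)))%:E : \bar R))%E; last first.
  rewrite integral_cst//= lebesgue_measure_itv/= lte_fin.
  case: ltP => h; first by rewrite -EFinB -EFinM mulrC.
  have -> : a ord0 = b ord0 by apply/eqP; rewrite eq_le ab h.
  by rewrite subrr mul0r mule0.
rewrite [RHS]integral_mkcond; apply: eq_integral => x _; rewrite patchE.
have e0 : lshift d ord0 = ord0 :> 'I_(1 + d) by apply: val_inj.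
have eS i : rshift 1 i = lift ord0 i :> 'I_(1 + d) by apply: val_inj.
have r0 (y : 'rV[R]_d) : row_mx (const_mx x : 'rV_1) y ord0 ord0 = x.
  by rewrite -[X in row_mx _ _ _ X]e0 row_mxEl mxE.
have rS (y : 'rV[R]_d) i : row_mx (const_mx x : 'rV_1) y ord0 (lift ord0 i) = y ord0 i.
  by rewrite -[X in row_mx _ _ _ X]eS row_mxEr.
case: ifPn => hx.
  rewrite -(IH _ _ (fun i => ab (lift ord0 i))).
  apply: (f_equal (@lebesgue_rV R d)); apply/seteqP; split => y /= h i.
    by rewrite -rS; exact: h.
  case: (unliftP ord0 i) => [j ->|->].
    by rewrite rS; exact: h.
  by rewrite r0; move: hx; rewrite inE/= in_itv.
rewrite [X in lebesgue_rV X](_ : _ = set0) ?lebesgue_rV_set0//.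
apply/seteqP; split => y //= /(_ ord0); rewrite r0 => h.
by move/negP: hx; apply; rewrite inE /= in_itv.
Qed.

Section measures.
Variables (R : realType) (d : nat).

Definition msupport (nu : set 'rV[R]_d -> \bar R) : set 'rV[R]_d :=
  [set x | forall U : set 'rV[R]_d, open U -> U x -> (0 < nu U)%E].

Definition standard (nu : set 'rV[R]_d -> \bar R) (S : set 'rV[R]_d) : Prop :=
  exists lambda delta : R, [/\ 0 < lambda, 0 < delta &
    forall x (e : R), S x -> 0 < e <= lambda ->
      (delta%:E * lebesgue_rV (eball x e) <= nu (eball x e `&` S))%E].

End measures.

Section iid.
Context {d1 d2 : measure_display} {Omega : measurableType d1}
  {T : measurableType d2} {R : realType} (P : probability Omega R).

Definition mutually_independent (X : nat -> {RV P >-> T}) : Prop :=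
  forall (s : seq nat) (A : nat -> set T), uniq s ->
    (forall i, measurable (A i)) ->
    (P (\bigcap_(i in [set` s]) (X i @^-1` A i)) =
     \prod_(i <- s) P (X i @^-1` A i))%E.

Definition iid_from (PX : probability T R) (X : nat -> {RV P >-> T}) : Prop :=
  mutually_independent X /\
  forall i (A : set T), measurable A -> distribution P (X i) A = PX A.

End iid.

(* The first n observations; indices start at 0. *)
Definition sample {Omega E : Type} (X : nat -> Omega -> E) (n : nat)
  (w : Omega) : set E := [set X i w | i in `I_n].

Definition rho' {R : realType} (rho : R) : R :=
  if rho <= pi / 3 then rho else (pi - rho) / 2.

(* Main.v *)
Require Import Defs.
From mathcomp Require Import all_boot all_order all_algebra.
From mathcomp Require Import all_classical all_reals all_analysis.
From mathcomp Require Import ring lra.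

Set Implicit Arguments.
Unset Strict Implicit.
Unset Printing Implicit Defensive.

Import Order.TTheory GRing.Theory Num.Theory.
Import numFieldNormedType.Exports.
Local Open Scope classical_set_scope.
Local Open Scope ring_scope.

(* Let [A] be the sample, [H] its hull and [A <= H <= S]; let every point of [S]
   be within [e] of [A].
   - A point [x] of the boundary of [S] is within [e] of some [a] in [A], hence in
     [H], and is not interior to [H]: the segment [a, x] meets the boundary of [H].
   - Near a point [x] of the boundary of [H] there is a point outside [H], hence a
     cone disjoint from [A].  For small [e] it contains a ball of radius [e], whose
     centre [c] is not in [S] and is at distance at most (2 + 2 / sin (rho / 2)) e
     from [x]: the segment [x, c] meets the boundary of [S].
   The second point works for both hulls with the same constant, because a cone of
   angle at most pi is convex.  Almost surely the sample eventually is an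
   [e]-net of the compact support [S], for the one [e] which makes the cones
   large enough. *)

(** * Euclidean inner product, norm and balls *)

Section euclidean_norm.
Variables (R : realType) (d : nat).
Implicit Types (x y z : 'rV[R]_d) (a : R).

Lemma dotpC x y : dotp x y = dotp y x.
Proof. by apply: eq_bigr => i _; rewrite mulrC. Qed.

Lemma dotpDr x y z : dotp x (y + z) = dotp x y + dotp x z.
Proof. by rewrite /dotp -big_split; apply: eq_bigr => i _; rewrite mxE mulrDr. Qed.

Lemma dotpZr a x y : dotp x (a *: y) = a * dotp x y.
Proof. by rewrite /dotp mulr_sumr; apply: eq_bigr => i _; rewrite mxE mulrCA. Qed.

Lemma dotpDl x y z : dotp (x + y) z = dotp x z + dotp y z.
Proof. by rewrite dotpC dotpDr !(dotpC z). Qed.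

Lemma dotpZl a x y : dotp (a *: x) y = a * dotp x y.
Proof. by rewrite dotpC dotpZr dotpC. Qed.

Lemma dotpxx_ge0 x : 0 <= dotp x x.
Proof. by apply: sumr_ge0 => i _; rewrite -expr2 sqr_ge0. Qed.

Lemma enorm_ge0 x : 0 <= enorm x.
Proof. exact: sqrtr_ge0. Qed.

Lemma sqr_enorm x : enorm x ^+ 2 = dotp x x.
Proof. by rewrite sqr_sqrtr// dotpxx_ge0. Qed.

Lemma enorm_eq0 x : enorm x = 0 -> x = 0.
Proof.
move=> x0; have /eqP : dotp x x = 0 by rewrite -sqr_enorm x0 expr0n.
rewrite psumr_eq0 => [/allP xi0|i _]; last by rewrite -expr2 sqr_ge0.
apply/rowP => i; rewrite mxE; apply/eqP.
by have := xi0 i; rewrite mem_index_enum => /(_ isT); rewrite /= mulf_eq0 orbb.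
Qed.

Lemma enorm0 : enorm (0 : 'rV[R]_d) = 0.
Proof. by rewrite /enorm /dotp big1 ?sqrtr0// => i _; rewrite mxE mul0r. Qed.

Lemma enormZ a x : enorm (a *: x) = `|a| * enorm x.
Proof.
by rewrite /enorm dotpZl dotpZr mulrA -expr2 sqrtrM ?sqr_ge0// sqrtr_sqr.
Qed.

Lemma enormN x : enorm (- x) = enorm x.
Proof. by rewrite -scaleN1r enormZ normrN1 mul1r. Qed.

Lemma enorm_subC x y : enorm (x - y) = enorm (y - x).
Proof. by rewrite -enormN opprB. Qed.

Lemma cauchy_schwarz x y : dotp x y <= enorm x * enorm y.
Proof.
have [x0|x0] := eqVneq (enorm x) 0.
  by rewrite (enorm_eq0 x0) enorm0 mul0r /dotp big1// => i _; rewrite mxE mul0r.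
have [y0|y0] := eqVneq (enorm y) 0.
  by rewrite (enorm_eq0 y0) enorm0 mulr0 /dotp big1// => i _; rewrite mxE mulr0.
have ab : 0 < enorm x * enorm y by rewrite mulr_gt0// lt0r enorm_ge0 ?x0 ?y0.
(* With [a], [b] the norms and [p] the inner product, this square equals [2ab(ab - p)], and
   [ab > 0]. *)
have := dotpxx_ge0 (enorm y *: x + (- enorm x) *: y).
rewrite !(dotpDl, dotpDr, dotpZl, dotpZr) -!sqr_enorm (dotpC y x).
move: ab; move: (dotp x y) (enorm x) (enorm y) => p a b; nra.
Qed.

Lemma ler_enormD x y : enorm (x + y) <= enorm x + enorm y.
Proof.
rewrite -ler_sqr ?nnegrE ?addr_ge0 ?enorm_ge0// sqr_enorm dotpDl !dotpDr.
by rewrite -!sqr_enorm (dotpC y x); have := cauchy_schwarz x y; nra.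
Qed.

Lemma enorm_triangle y x z : enorm (x - z) <= enorm (x - y) + enorm (y - z).
Proof. by have := ler_enormD (x - y) (y - z); rewrite addrA subrK. Qed.

(** The ambient topology comes from the sup norm: a sup ball of radius [e / (d + 1)] fits because
    [d (e / (d + 1))^2 < e^2], also when [d = 0]. *)
Lemma nbhs_eball x e : 0 < e -> nbhs x (eball x e).
Proof.
move=> e0; have d1 : 0 < d.+1%:R :> R by rewrite ltr0n.
apply/nbhs_ballP; exists (e / d.+1%:R); first exact: divr_gt0.
move=> y [_ xy]; rewrite /eball /= /enorm -[ltRHS]gtr0_norm// -sqrtr_sqr.
rewrite ltr_sqrt ?exprn_gt0//.
apply: (@le_lt_trans _ _ (d%:R * (e / d.+1%:R) ^+ 2)).
  rewrite -[d in d%:R]card_ord -sumr_const mulr_suml; apply: ler_sum => i _.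
  rewrite mul1r !mxE -expr2 -real_normK ?num_real// lerXn2r ?nnegrE//.
    by rewrite divr_ge0// ltW.
  by rewrite distrC; apply: ltW; exact: (xy ord0 i).
rewrite exprMn mulrCA -{2}[e ^+ 2]mulr1 ltr_pM2l ?exprn_gt0//.
by rewrite exprVn ltr_pdivrMr ?exprn_gt0// mul1r expr2 -natrM ltr_nat mulnS leq_addr.
Qed.

End euclidean_norm.

(** * Segments crossing a boundary *)

Section boundary.
Variables (R : realType) (d : nat).
Implicit Types (A : set 'rV[R]_d) (p q x : 'rV[R]_d).

(** Otherwise [closure A] and [interior A] cut the same subset out of the segment. It is open,
    closed and nonempty, hence everything by connectedness, which contradicts the choice of [q]. *)
Lemma segment_boundary A p q : closure A p -> ~ interior A q ->
  exists t : R, 0 <= t <= 1 /\ boundary A (p + t *: (q - p)).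
Proof.
move=> Ap Aq; apply: contrapT => noz.
pose f (t : R) := p + t *: (q - p).
have fc : continuous f.
  by move=> t; apply: cvgD; [exact: cvg_cst|apply: cvgZl; exact: cvg_id].
have BE : `[0, 1]%classic `&` f @^-1` closure A = `[0, 1]%classic `&` f @^-1` interior A.
  apply/seteqP; split => t [/= t01 ft]; split => //.
    by apply: contrapT => nft; apply: noz; exists t; split.
  by apply: subset_closure; exact: interior_subset.
have : `[0, 1]%classic `&` f @^-1` closure A = `[0, 1]%classic.
  apply: (@segment_connected R 0 1 (`[0, 1]%classic `&` f @^-1` closure A)).
  - by exists 0; split => /=; rewrite ?in_itv/= ?lexx ?ler01// /f scale0r addr0.
  - by exists (f @^-1` interior A); rewrite ?BE//; apply: open_comp;
      [move=> *; exact: fc|exact: open_interior].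
  - by exists (f @^-1` closure A) => //; apply: closed_comp;
      [move=> *; exact: fc|exact: closed_closure].
rewrite BE => /seteqP[_ /(_ 1)] /=; rewrite in_itv/= ler01 lexx => /(_ isT)[_].
by rewrite /f scale1r addrC subrK.
Qed.

Lemma enorm_segment p q (t : R) : 0 <= t <= 1 ->
  enorm (p - (p + t *: (q - p))) <= enorm (p - q).
Proof.
move=> /andP[t0 t1]; rewrite opprD addNKr enormN enormZ ger0_norm//.
by rewrite enorm_subC ler_piMl// enorm_ge0.
Qed.

Lemma closure_eball A x e : 0 < e -> closure A x ->
  exists2 y, A y & enorm (x - y) < e.
Proof.
move=> e0 /(_ _ (nbhs_eball x e0))[y [Ay xy]]; exists y => //.
by rewrite enorm_subC.
Qed.

Lemma not_interior_eball A x e : 0 < e -> ~ interior A x ->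
  exists2 y, ~ A y & enorm (x - y) < e.
Proof.
move=> e0 nAx; apply: contrapT => H; apply: nAx.
apply: filterS (nbhs_eball x e0) => y xy; apply: contrapT => nAy.
by apply: H; exists y => //; rewrite enorm_subC.
Qed.

End boundary.

(** * Cones and the balls they contain *)

Section cones.
Variables (R : realType) (d : nat).
Implicit Types (x y z xi : 'rV[R]_d).

Lemma sub_cone rho xi h y z : enorm (z - y) < h ->
  cos (rho / 2) * enorm (z - y) < dotp xi (z - y) -> cone rho xi h y z.
Proof.
move=> zyh zc; have zy : z != y.
  apply/eqP => E; move: zc; rewrite E subrr enorm0 mulr0 /dotp big1 ?ltxx// => i _.
  by rewrite mxE mulr0.
split => //; split => //.
have n0 : 0 < enorm (z - y).
  rewrite lt0r enorm_ge0 andbT; apply: contra_neq zy => /enorm_eq0/eqP.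
  by rewrite subr_eq0 => /eqP.
by rewrite dotpZr ltr_pdivlMl// [enorm _ * _]mulrC.
Qed.

(** The inequalities are weakened to non-strict ones so that they have the form of those that hold
    at the apex, the point used for [cone_hull]. *)
Lemma cone_bounds rho xi h y z : cone rho xi h y z ->
  enorm (z - y) <= h /\ cos (rho / 2) * enorm (z - y) <= dotp xi (z - y).
Proof.
move=> [/= zyh [zy]]; have n0 : 0 < enorm (z - y).
  rewrite lt0r enorm_ge0 andbT; apply: contra_neq zy => /enorm_eq0/eqP.
  by rewrite subr_eq0 => /eqP.
by rewrite dotpZr ltr_pdivlMl// [enorm _ * _]mulrC => /ltW ?; split => //; exact: ltW.
Qed.

(* [c] and [s] are the cosine and sine of the half-angle: a ball centred on the
   axis at distance [b] from the apex is tangent to the lateral surface when its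
   radius is [b * s]. *)
Lemma inscribed_ball_cone (c s b : R) xi w : enorm xi = 1 -> 0 < b ->
  0 <= c -> 0 < s -> c ^+ 2 + s ^+ 2 = 1 -> enorm w < b * s ->
  c * enorm (b *: xi + w) < dotp xi (b *: xi + w).
Proof.
move=> xi1 b0 c0 s0 cs wbs.
have s1 : s <= 1 by nra.
have w0 := enorm_ge0 w.
have p_lb : - (b * s) < dotp xi w.
  rewrite ltrNl -mulN1r -dotpZr; apply: le_lt_trans (cauchy_schwarz _ _) _.
  by rewrite xi1 mul1r enormZ normrN1 mul1r.
have bs : b * s <= b by rewrite ler_piMr// ltW.
have E : dotp xi (b *: xi + w) = b + dotp xi w.
  by rewrite dotpDr dotpZr -sqr_enorm xi1 expr1n mulr1.
rewrite E -ltr_sqr ?nnegrE ?mulr_ge0 ?enorm_ge0//; last lra.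
rewrite exprMn sqr_enorm dotpDl dotpZl E dotpDr dotpZr (dotpC w xi).
rewrite -!sqr_enorm.
set q := enorm w in w0 wbs *; set p := dotp xi w in p_lb *.
have bp : 0 < b + p by lra.
have q2 : q ^+ 2 < b ^+ 2 * s ^+ 2 by rewrite -exprMn ltr_sqr ?nnegrE//; lra.
(* For a half-space ([c = 0]) only [b + p > 0] is needed; otherwise completing the square leaves a
   positive multiple of [b^2 s^2 - q^2]. *)
have [c00|cn0] := eqVneq c 0.
  by rewrite c00 expr0n mul0r exprn_gt0.
have c2 : 0 < c ^+ 2 by rewrite exprn_even_gt0.
rewrite -subr_gt0.
suff -> : (b + p) ^+ 2 - c ^+ 2 * (b * (b + p) + (b * p + q ^+ 2)) =
    (p + b * s ^+ 2) ^+ 2 + c ^+ 2 * (b ^+ 2 * s ^+ 2 - q ^+ 2).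
  by rewrite ltr_wpDl ?sqr_ge0// mulr_gt0// subr_gt0.
have -> : c ^+ 2 = 1 - s ^+ 2 by lra.
ring.
Qed.

(* The inscribed ball of the cone has radius [h s / (1 + s)] and centre at
   distance [h / (1 + s)] from the apex; shrinking it towards [x] keeps it inside,
   since the cone is convex. *)
Lemma eball_in_cone rho xi h y x e : 0 < rho <= pi -> 0 < h -> enorm xi = 1 ->
  enorm (x - y) <= h -> cos (rho / 2) * enorm (x - y) <= dotp xi (x - y) ->
  0 < e <= h * sin (rho / 2) / (1 + sin (rho / 2)) ->
  exists c, enorm (x - c) <= (1 + 2 / sin (rho / 2)) * e /\
            eball c e `<=` cone rho xi h y.
Proof.
move=> /andP[rho0 rhopi] h0 xi1; set s := sin _; set co := cos _.
move=> xyh xyc /andP[e0 er0].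
have pi0 := pi_gt0 R.
have s0 : 0 < s by rewrite sin_gt0_pi//; apply/andP; split; lra.
have c0 : 0 <= co by rewrite cos_ge0_pihalf//; apply/andP; split; lra.
have cs : co ^+ 2 + s ^+ 2 = 1 by rewrite /co cos2Dsin2.
(* [t] is the ratio of the homothety centred at [x] that takes the inscribed ball, of centre
   [y + a xi], to a ball of radius [e]. *)
pose a := h / (1 + s); pose t := e / (h * s / (1 + s)).
have s10 : 0 < 1 + s by lra.
have a0 : 0 < a by rewrite divr_gt0.
have aE : a + a * s = h by rewrite -{1}[a]mulr1 -mulrDr divfK// gt_eqF.
have tE : e = t * a * s.
  by rewrite /t /a; field; rewrite !gt_eqF.
have t0 : 0 < t by rewrite divr_gt0// divr_gt0// mulr_gt0.
have t1 : t <= 1 by rewrite ler_pdivrMr ?mul1r// divr_gt0// mulr_gt0.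
exists (x + t *: (a *: xi - (x - y))); split.
  rewrite opprD addNKr enormN enormZ gtr0_norm//.
  have := ler_enormD (a *: xi) (- (x - y)); rewrite enormN enormZ xi1 mulr1 gtr0_norm//.
  move=> le1; apply: (@le_trans _ _ (t * (a + h))).
    by rewrite ler_pM2l//; lra.
  have -> : (1 + 2 / s) * e = t * (a * s + 2 * a) by rewrite tE; field; rewrite gt_eqF.
  by rewrite ler_pM2l// -aE; lra.
move=> z /=; rewrite /eball /=; set w := z - _ => we.
have zE : z - y = (1 - t) *: (x - y) + ((t * a) *: xi + w).
  by rewrite /w; apply/rowP => i; rewrite !mxE; ring.
have ta0 : 0 < t * a by rewrite mulr_gt0.
have t1' : 0 <= 1 - t by rewrite subr_ge0.
apply: sub_cone.
  rewrite zE; apply: le_lt_trans (ler_enormD _ _) _.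
  have := ler_enormD ((t * a) *: xi) w; rewrite !enormZ xi1 mulr1 gtr0_norm// ger0_norm//.
  move: we; rewrite tE.
  have : (1 - t) * enorm (x - y) <= (1 - t) * h by rewrite ler_wpM2l.
  by rewrite -aE; nra.
have C := @inscribed_ball_cone co s (t * a) xi w xi1 ta0 c0 s0 cs.
rewrite zE [dotp _ _]dotpDr dotpZr; apply: le_lt_trans (ler_wpM2l c0 (ler_enormD _ _)) _.
rewrite mulrDr enormZ ger0_norm//; apply: ler_ltD; last by apply: C; rewrite -tE.
by rewrite mulrCA ler_wpM2l.
Qed.

End cones.

(** * Deterministic bounds on the Hausdorff distance *)

Section hausdorff.
Variables (R : realType) (d : nat).
Implicit Types (A B S H : set 'rV[R]_d).

(** The infimum need not be attained, so every admissible radius is treated; one above [e0] is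
    replaced by [e0], itself admissible. *)
Lemma hausdorff_le_scaled A B A' B' (k e0 : R) : 0 < k -> 0 < e0 ->
  A `<=` \bigcup_(b in B) eball b e0 -> B `<=` \bigcup_(a in A) eball a e0 ->
  (forall e, 0 < e <= e0 ->
    A `<=` \bigcup_(b in B) eball b e -> B `<=` \bigcup_(a in A) eball a e ->
    A' `<=` \bigcup_(b in B') eball b (k * e) /\
    B' `<=` \bigcup_(a in A') eball a (k * e)) ->
  (hausdorff A' B' <= k%:E * hausdorff A B)%E.
Proof.
move=> k0 e00 AB0 BA0 AB'.
have le_k e : 0 < e <= e0 -> A `<=` \bigcup_(b in B) eball b e ->
    B `<=` \bigcup_(a in A) eball a e -> (hausdorff A' B' <= (k * e)%:E)%E.
  move=> /andP[ep ee0] AB BA; apply: ereal_inf_lbound; exists (k * e) => //=.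
  by split; [rewrite mulr_gt0|apply: AB' => //; rewrite ep].
rewrite -lee_pdivrMl//; apply: le_ereal_inf_tmp => _ [e /= [ep [AB BA]] <-].
rewrite lee_pdivrMl// -EFinM.
have [ee0|/ltW e0e] := leP e e0; first by apply: le_k => //; rewrite ep.
apply: le_trans (le_k e0 _ AB0 BA0) _; first by rewrite e00 lexx.
by rewrite lee_fin ler_pM2l.
Qed.

(* [H] stands for either hull: a point outside of it near a point of it sees,
   at a smaller distance, a cone disjoint from the sample. *)
Definition separated_by_cones rho h A H : Prop :=
  forall x x', H x -> ~ H x' -> exists y xi z, [/\ enorm xi = 1,
    cone rho xi h y `&` A = set0, enorm (x - z) <= enorm (x - x'),
    enorm (z - y) <= h & cos (rho / 2) * enorm (z - y) <= dotp xi (z - y)].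

Lemma boundary_near rho h A S H (k e : R) : 0 < rho <= pi -> 0 < h ->
  compact S -> A `<=` H -> H `<=` S -> separated_by_cones rho h A H ->
  3 + 2 / sin (rho / 2) <= k ->
  0 < e <= h * sin (rho / 2) / (1 + sin (rho / 2)) ->
  S `<=` \bigcup_(a in A) eball a e ->
  boundary S `<=` \bigcup_(b in boundary H) eball b (k * e) /\
  boundary H `<=` \bigcup_(b in boundary S) eball b (k * e).
Proof.
move=> rhob h0 cS AH HS sep ke ebnd SA.
have /andP[rho0 rhopi] := rhob; have /andP[e0 _] := ebnd.
have pi0 := pi_gt0 R.
have s0 : 0 < sin (rho / 2) by rewrite sin_gt0_pi//; apply/andP; split; lra.
have s0' : 0 < 2 / sin (rho / 2) by rewrite divr_gt0.
have Scl : closed S by apply: compact_closed => //; exact: norm_hausdorff.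
split => x [clx nix].
  have Sx : S x by apply: Scl.
  have [a Aa xa] := SA _ Sx.
  have nHx : ~ interior H x by move=> /(interiorS HS).
  have [t [t01 bz]] := segment_boundary (subset_closure (AH _ Aa)) nHx.
  exists (a + t *: (x - a)) => //.
  apply: le_lt_trans (enorm_triangle a _ _) _.
  move: (enorm_segment a x t01) xa; rewrite /eball /= (enorm_subC x a) => *.
  by nra.
(* [x] need not lie in [H], so [x1] in [H] and [x2] outside are both taken within [e / 2]. Then [z]
   is within [3e / 2] of [x], and [c] within [(5 / 2 + 2 / sin (rho / 2)) e]. *)
have e20 : 0 < e / 2 by rewrite divr_gt0.
have [x1 Hx1 xx1] := closure_eball e20 clx.
have [x2 nHx2 xx2] := not_interior_eball e20 nix.
have [y [xi [z [xi1 CA x1z zh zc]]]] := sep _ _ Hx1 nHx2.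
have [c [zce cC]] := eball_in_cone rhob h0 xi1 zh zc ebnd.
have nSc : ~ S c.
  move=> /SA[a Aa ac]; suff : set0 a by [].
  by rewrite -CA; split => //; apply: cC; rewrite /eball /= enorm_subC.
have clSx : closure S x by exact: (closure_subset HS).
have [t [t01 bz]] := segment_boundary clSx (contra_not (@interior_subset _ _ _) nSc).
exists (x + t *: (c - x)) => //=.
apply: le_lt_trans (enorm_segment x c t01) _.
have := enorm_triangle x1 x z; have := enorm_triangle z x c.
by have := enorm_triangle x x1 x2; rewrite (enorm_subC x1 x); nra.
Qed.

(** Some cone-convex [B] containing [A] misses [x']. The segment from [x] to [x'] meets its boundary
    at a point [z], which is the apex of a cone avoiding [B]. *)
Lemma cone_hull_separated rho h A : 0 <= h -> separated_by_cones rho h A (cone_hull rho h A).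
Proof.
move=> h0 x x' Hx nHx'.
have [B [[CB AB] nBx']] : exists B, (cone_convex rho h B /\ A `<=` B) /\ ~ B x'.
  apply: contrapT => nB; apply: nHx' => B BP.
  by apply: contrapT => nBx'; apply: nB; exists B.
have Bx : B x by exact: Hx.
have [t [t01 bz]] := segment_boundary (subset_closure Bx)
  (contra_not (@interior_subset _ _ _) nBx').
have [B0 cB /(_ _ bz)[xi [xi1 nB]]] := CB.
set z := x + _ in bz nB; exists z, xi, z; split => //.
- by apply/seteqP; split => // a [/nB nBa /AB].
- exact: enorm_segment.
- by rewrite subrr enorm0.
- by rewrite subrr enorm0 mulr0 /dotp big1// => i _; rewrite mxE mulr0.
Qed.

(** Here [x'] itself lies in one of the removed cones, so [z] is [x']. *)
Lemma cone_hull_compl_separated rho h A :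
  separated_by_cones rho h A (cone_hull_compl rho h A).
Proof.
move=> x x' Hx nHx'.
have [C [[y [xi [xi1 -> CA]]] Cx']] : exists C, (exists y xi,
      [/\ enorm xi = 1, C = cone rho xi h y & C `&` A = set0]) /\ C x'.
  apply: contrapT => nC; apply: nHx' => C CP Cx'; apply: nC; by exists C.
by have [? ?] := cone_bounds Cx'; exists y, xi, x'; split.
Qed.

End hausdorff.

(** * The support of a Borel probability *)

Section support.
Variables (R : realType) (d : nat).
Implicit Types (U S : set 'rV[R]_d).

(** A countable base of the topology, made of sup-norm balls; integers that code no ball give the
    empty set. *)
Definition rational_ball (k : nat) : set 'rV[R]_d :=
  if (unpickle k : option ('rV[rat]_d * nat)) is Some (q, m) then
    ball (map_mx ratr q : 'rV[R]_d) m.+1%:R^-1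
  else set0.

Lemma open_rational_ball k : open (rational_ball k).
Proof.
rewrite /rational_ball; case: unpickle => [[q m]|]; last exact: open0.
by apply: ball_open; rewrite invr_gt0 ltr0n.
Qed.

Lemma rational_ball_basis U x : open U -> U x ->
  exists k, rational_ball k x /\ rational_ball k `<=` U.
Proof.
move=> oU Ux; have /nbhs_ballP[e /= e0 xU] : nbhs x U by exact: open_nbhs_nbhs.
have [m me] : exists m : nat, m.+1%:R^-1 < e / 2.
  exists (Num.bound (2 / e)); rewrite -[e / 2]invrK ltf_pV2 ?posrE ?invr_gt0 ?divr_gt0//.
  rewrite invf_div; apply: lt_trans (archi_boundP _) _; first by rewrite divr_ge0// ltW.
  by rewrite ltr_nat.
set r := m.+1%:R^-1 in me *; have r0 : 0 < r by rewrite invr_gt0.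
have /choice[q qx] : forall i : 'I_d, exists q : rat, `|ratr q - x ord0 i| < r.
  move=> i; have [|q] := @rat_in_itvoo R (x ord0 i - r) (x ord0 i + r); first lra.
  by rewrite in_itv/= => qx; exists q; rewrite ltr_distl.
have qE i j : (map_mx ratr (\row_j q j) : 'rV[R]_d) i j = ratr (q j) by rewrite !mxE.
exists (pickle (\row_j q j, m)); rewrite /rational_ball pickleK; split.
  by split => // i j; rewrite qE (ord1 i) -ball_normE/=.
move=> y [_ qy]; apply: xU; split => // i j.
have -> : i = ord0 by exact: ord1.
rewrite -ball_normE/=; apply: le_lt_trans (ler_distD (ratr (q j)) _ _) _.
have xq : `|x ord0 j - ratr (q j)| < r by rewrite distrC.
have yq : `|ratr (q j) - y ord0 j| < r.
  by have := qy ord0 j; rewrite qE -ball_normE.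
by apply: lt_trans (ltrD xq yq) _; rewrite [e]splitr ltrD.
Qed.

Variable PX : probability (borel_rV R d) R.

Lemma measurable_open U : open U -> measurable (U : set (borel_rV R d)).
Proof. by move=> oU; exact: sub_sigma_algebra. Qed.

(** Each point off the support lies in a null rational ball, and there are countably many of
    these. *)
Lemma negligible_setC_msupport : PX.-negligible (~` msupport PX).
Proof.
pose N k : set (borel_rV R d) :=
  if PX (rational_ball k) == 0%E then rational_ball k else set0.
apply: (@negligibleS _ _ _ PX (\bigcup_k N k)).
  move=> x /= /existsNP[U /not_implyP[oU /not_implyP[Ux]]].
  move=> /negP; rewrite -leNgt measure_le0 => /eqP U0.
  have [k [kx kU]] := rational_ball_basis oU Ux.
  exists k => //; rewrite /N; case: ifPn => // /negP; apply.
  rewrite -measure_le0 -U0 le_measure// inE; apply: measurable_open => //.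
  exact: open_rational_ball.
apply: negligible_bigcup => k; rewrite /N; case: ifPn => [/eqP k0|_]; last exact: negligible_set0.
by apply/negligibleP => //; apply: measurable_open; exact: open_rational_ball.
Qed.

End support.

(** * Almost sure properties of an i.i.d. sequence *)

Section iid.
Context (d1 d2 : measure_display) (Omega : measurableType d1)
  (T : measurableType d2) (R : realType) (P : probability Omega R)
  (PX : probability T R) (X : nat -> {RV P >-> T}).

Lemma iid_ae_in (A : set T) : iid_from PX X -> measurable A ->
  PX.-negligible (~` A) -> {ae P, forall w, forall i, A (X i w)}.
Proof.
move=> [_ XPX] mA NA; apply: ae_foralln => i.
have mCA : measurable (~` A) by exact: measurableC.
apply/negligibleP; first exact: (measurable_funPTI (X i) mCA).
by apply: etrans (XPX i _ mCA) _; apply/negligibleP.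
Qed.

(** By independence the first [n] terms all miss [A] with probability [q ^ n], where [q < 1] is the
    mass of the complement. *)
Lemma iid_ae_hit (A : set T) : iid_from PX X -> measurable A ->
  (0 < PX A)%E -> {ae P, forall w, exists i, A (X i w)}.
Proof.
move=> [indep XPX] mA PA0.
have mCA : measurable (~` A) by exact: measurableC.
have mXA i : measurable (X i @^-1` ~` A) by exact: (measurable_funPTI (X i) mCA).
pose q := fine (PX (~` A)).
have qE : PX (~` A) = q%:E by rewrite fineK// fin_num_measure.
have q0 : 0 <= q by rewrite fine_ge0.
have q1 : q < 1.
  rewrite -lte_fin -qE probability_setC// -[PX A]fineK ?fin_num_measure//.
  by rewrite -EFinB lte_fin ltrBlDr ltrDl fine_gt0// PA0 ltey_eq fin_num_measure.
have mI : measurable (\bigcap_i (X i @^-1` ~` A)) by exact: bigcapT_measurable.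
apply: (@negligibleS _ _ _ _ (\bigcap_i (X i @^-1` ~` A))).
  by move=> w /= /forallNP nA i _; exact: nA.
apply/negligibleP => //.
have Pq n : (P (\bigcap_i (X i @^-1` ~` A)) <= (q ^+ n)%:E)%E.
  apply: (@le_trans _ _ (P (\bigcap_(i in [set` iota 0 n]) (X i @^-1` ~` A)))).
    apply: le_measure; rewrite ?inE//; first exact: bigcap_measurableType.
    by move=> w wI i _; exact: wI.
  rewrite (indep _ (fun=> ~` A))//; last exact: iota_uniq.
  rewrite (eq_bigr (fun=> q%:E)); last by move=> i _; rewrite -qE; exact: XPX.
  rewrite le_eqVlt; apply/orP; left; apply/eqP.
  rewrite big_const_seq count_predT size_iota.
  by elim: n => //= n ->; rewrite exprS EFinM.
apply/eqP; rewrite -measure_le0; apply/lee_addgt0Pr => e e0; rewrite add0e.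
have q1' : `|q| < 1 by rewrite ger0_norm.
have /cvgrPdist_lt /(_ _ e0)[N _ /(_ N (leqnn N))] := cvg_expr q1'.
rewrite /= sub0r normrN ger0_norm ?exprn_ge0// => qe.
by apply: le_trans (Pq N) _; rewrite lee_fin ltW.
Qed.

End iid.

(** * The sample is eventually a net of the support *)

Section sample_covering.
Variables (R : realType) (d : nat).

Lemma open_eball (x : 'rV[R]_d) e : open (eball x e).
Proof.
suff nbhs_x (y : 'rV[R]_d) : eball x e y -> nbhs y (eball x e) by rewrite openE.
move=> xy; have e0 : 0 < e - enorm (y - x) by rewrite subr_gt0.
apply: filterS (nbhs_eball y e0) => z; rewrite /eball /= ltrBrDr => zy.
exact: le_lt_trans (enorm_triangle y _ _) zy.
Qed.

Lemma compact_sample_cover (S : set 'rV[R]_d) (u : nat -> 'rV[R]_d) e :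
  compact S -> (forall U, open U -> S `&` U !=set0 -> exists i, U (u i)) ->
  0 < e -> \forall n \near \oo, S `<=` \bigcup_(a in [set u i | i in `I_n]) eball a e.
Proof.
move=> cS hit e0; move: cS; rewrite compact_cover => cS.
have [i _|x Sx|D _ SD] := cS nat setT (fun i => eball (u i) e).
- exact: open_eball.
- have [|i xi] := hit (eball x e) (@open_eball x e).
    by exists x; split => //; rewrite /eball /= subrr enorm0.
  by exists i => //; rewrite /eball /= enorm_subC.
(* [D] indexes a finite subcover; the successor is there because [I_n] stops before [n]. *)
exists (\max_(i <- finmap.enum_fset D) i).+1 => // n /= Dn x /SD[i iD xi].
exists (u i) => //; exists i => //=; apply: leq_trans Dn.
by rewrite ltnS; apply: (@leq_bigmax_seq _ _ xpredT id).
Qed.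

End sample_covering.

Lemma iid_ae_cover (R : realType) (d : nat) (disp : measure_display)
    (Omega : measurableType disp) (P : probability Omega R)
    (PX : probability (borel_rV R d) R) (X : nat -> {RV P >-> borel_rV R d})
    (e : R) :
  iid_from PX X -> compact (msupport PX) -> 0 < e ->
  {ae P, forall w, \forall n \near \oo, sample X n w `<=` msupport PX /\
    msupport PX `<=` \bigcup_(a in sample X n w) eball a e}.
Proof.
move=> hX cS e0.
have mS : measurable (msupport PX : set (borel_rV R d)).
  rewrite -[X in measurable X]setCK; apply: measurableC; apply: measurable_open.
  by apply: closed_openC; apply: compact_closed => //; exact: norm_hausdorff.
have inS := iid_ae_in hX mS (negligible_setC_msupport PX).
(* Restricting to the countable base keeps a single null set; arbitrary open sets follow in
   [hitU]. *)
have hit : {ae P, forall w, forall k, (0 < PX (rational_ball k))%E ->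
    exists i, rational_ball k (X i w)}.
  apply: ae_foralln => k; have [k0|k0] := pselect (0 < PX (rational_ball k))%E.
    have mk := measurable_open (@open_rational_ball R d k).
    by apply: filterS (iid_ae_hit hX mk k0) => w.
  by apply: filterE => w /k0.
apply: filterS2 inS hit => w inS hit.
have hitU U : open U -> msupport PX `&` U !=set0 -> exists i, U (X i w).
  move=> oU [x [Sx Ux]]; have [k [kx kU]] := rational_ball_basis oU Ux.
  have [i ki] := hit k (Sx _ (@open_rational_ball R d k) kx).
  by exists i; exact: kU.
apply: filterS (compact_sample_cover cS hitU e0) => n cover; split => //.
by move=> _ [i _ <-]; exact: inS.
Qed.

(** * Comparison of constants and conclusion *)

(** Makes the constant of (b) at least that of (a): [rho' rho <= rho], since
    [(pi - rho) / 2 < pi / 3] when [rho > pi / 3], and sine increases up to [pi / 2]. *)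
Lemma sin_rho'_bounds (R : realType) (rho : R) : 0 < rho < pi ->
  0 < sin (rho' rho / 2) <= sin (rho / 2).
Proof.
move=> /andP[rho0 rhopi]; have pi0 := pi_gt0 R.
have [r0 rle] : 0 < rho' rho /\ rho' rho <= rho.
  by rewrite /rho'; case: (leP rho (pi / 3)) => ?; split; lra.
rewrite sin_gt0_pi/=; last by apply/andP; split; lra.
have [->//|lt] := eqVneq (rho' rho) rho.
apply: ltW; rewrite ltr_sin ?in_itv/=; try (apply/andP; split; lra).
by rewrite ltr_pM2r// lt_neqAle lt.
Qed.

Lemma hausdorff_boundary_le (R : realType) (d : nat) (rho h k : R)
    (A S H : set 'rV[R]_d) :
  0 < rho <= pi -> 0 < h -> compact S -> A `<=` H -> H `<=` S ->
  separated_by_cones rho h A H -> 3 + 2 / sin (rho / 2) <= k ->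
  S `<=` \bigcup_(a in A) eball a (h * sin (rho / 2) / (1 + sin (rho / 2))) ->
  (hausdorff (boundary S) (boundary H) <= k%:E * hausdorff S A)%E.
Proof.
move=> rhob h0 cS AH HS sep ke SA; have /andP[rho0 rhopi] := rhob.
have pi0 := pi_gt0 R.
have s0 : 0 < sin (rho / 2) by rewrite sin_gt0_pi//; apply/andP; split; lra.
have k0 : 0 < k by apply: lt_le_trans ke; rewrite addr_gt0// divr_gt0.
have e0 : 0 < h * sin (rho / 2) / (1 + sin (rho / 2)).
  by rewrite divr_gt0 ?mulr_gt0// addr_gt0.
apply: (hausdorff_le_scaled k0 e0 SA).
  move=> a Aa; exists a; first by apply: HS; exact: AH.
  by rewrite /eball /= subrr enorm0.
by move=> e eb SAe _; exact: (boundary_near rhob h0 cS AH HS sep ke eb SAe).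
Qed.

Theorem corollary1 (R : realType) (d : nat) (hd : (0 < d)%N)
    (rho h : R) (hrho : 0 < rho <= pi) (hh : 0 < h)
    (disp : measure_display) (Omega : measurableType disp)
    (P : probability Omega R)
    (PX : probability (borel_rV R d) R)
    (X : nat -> {RV P >-> borel_rV R d})
    (hX : iid_from PX X)
    (S : set 'rV[R]_d) (hS : S = msupport PX)
    (hSc : compact S) (hSs : standard PX S)
    (hO : (fun t : R => fine (PX (S `\` inner_parallel S t)))
            =O_ (0^'+) (fun t : R => t)) :
  (cone_convex rho h S ->
     {ae P, forall w, \forall n \near \oo,
       (hausdorff (boundary S) (boundary (cone_hull rho h (sample X n w)))
        <= (3 + 2 / sin (rho / 2))%:E * hausdorff S (sample X n w))%E})
  /\
  (rho < pi -> cone_convex_compl rho h S ->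
     {ae P, forall w, \forall n \near \oo,
       (hausdorff (boundary S) (boundary (cone_hull_compl rho h (sample X n w)))
        <= (3 + 2 / sin (rho' rho / 2))%:E * hausdorff S (sample X n w))%E}).
Proof.
have /andP[rho0 rhopi] := hrho; have pi0 := pi_gt0 R.
have s0 : 0 < sin (rho / 2) by rewrite sin_gt0_pi//; apply/andP; split; lra.
have e0 : 0 < h * sin (rho / 2) / (1 + sin (rho / 2)).
  by rewrite divr_gt0 ?mulr_gt0// addr_gt0.
have cSupp : compact (msupport PX) by rewrite -hS.
have cover := iid_ae_cover hX cSupp e0; rewrite -hS in cover.
split => [CS|rho_lt CS]; apply: filterS cover => w; apply: filterS => n [AS SA].
- apply: hausdorff_boundary_le SA => //.
  + exact: sub_smallest.
  + by apply: smallest_sub.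
  + by apply: cone_hull_separated; exact: ltW.
- have /andP[s'0 s's] := @sin_rho'_bounds R rho ltac:(by rewrite rho0 rho_lt).
  apply: (@hausdorff_boundary_le _ _ rho h) SA => //.
  + by move=> a Aa C [y [xi [_ _ CA]]] Ca; have : set0 a by rewrite -CA.
  (* A cone disjoint from [S] is disjoint from the sample, so the hull of the sample lies in that of
     [S], which is [S]. *)
  + have [_ _ SE] := CS; move=> x Hx; rewrite SE => C [y [xi [xi1 CE CS0]]].
    apply: Hx; exists y, xi; split => //; apply/seteqP; split => // a [Ca /AS Sa].
    by rewrite -CS0.
  + exact: cone_hull_compl_separated.
  + by rewrite lerD2l ler_pM2l// lef_pV2 ?posrE.
Qed.
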